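(* Let $1\le k\le n$, let $\mathcal S\subset\mathcal P_n$ be the stabilizer group of an $[[n,k,d]]$ stabilizer code with logical Pauli group $\mathcal L$, let $D$ be a decoding map, and let $\tilde G\subset\tilde{\mathcal P}_n$ be a nontrivial subgroup (the decoupling group). Let $p\in[0,1)$, $z=p/(3-3p)$, $p_{\rm DD}\in[0,1]$ and $p_{\rm QEC}\in[0,1]$. Then the entanglement infidelity of the logical channel produced by the hybrid LDD+QEC protocol with these parameters is $$1-F_{\rm Hyb}=\frac{\bigl[W(U\setminus K)+p_{\rm QEC}\bigl(W((U\cap K)\setminus T)-4^{-k}W(U\setminus N)\bigr)\bigr]+p_{\rm DD}\bigl[W(V\setminus K)+p_{\rm QEC}\bigl(W((V\cap K)\setminus T)-4^{-k}W(V\setminus N)\bigr)\bigr]}{W(U)+p_{\rm DD}W(V)},$$ where $W(A)=W(A;z)$ and $T,N,K,U,V$ are the sets defined in the context.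
   Context: Paulis. $\mathcal P_n$ is the $n$-qubit Pauli group (with phases $\pm1,\pm i$), $\tilde{\mathcal P}_n=\mathcal P_n/\langle iI\rangle$, and $\pi:\mathcal P_n\to\tilde{\mathcal P}_n$ is the projection. Elements of $\tilde{\mathcal P}_n$ are represented by strings in $\{I,X,Y,Z\}^n$; $\mathrm{wt}(E')$ is the number of non-identity letters. Two elements of $\tilde{\mathcal P}_n$ are said to commute (anticommute) if their representatives in $\mathcal P_n$ do. Code. $\mathcal S\subset\mathcal P_n$ is a subgroup with $2^{n-k}$ elements not containing $-I$. $C(\mathcal S)$ is its centralizer in $\mathcal P_n$. $\mathcal L\subseteq C(\mathcal S)$ is a subgroup with $C(\mathcal S)=\mathcal S\mathcal L$ and $\pi(\mathcal S)\cap\pi(\mathcal L)=\{\pi(I)\}$. $\mathcal S^*$ is the $\mathbb F_2$-dual of $\mathcal S$; the syndrome $\mathrm{syn}(E')\in\mathcal S^*$ is given by $\mathrm{syn}(E')(s)=1$ iff $E'$ anticommutes with $s$. A decoding map is a map $D:\mathcal S^*\to\tilde{\mathcal P}_n$ with $D(0)=\pi(I)$ and $\mathrm{syn}(D(\sigma))=\sigma$ for all $\sigma$. Sets. $T=\pi(\mathcal S)$ (stabilizers); $N=\pi(\mathcal S\mathcal L)=\pi(C(\mathcal S))$ (zero-syndrome errors); $K=\{E'\in\tilde{\mathcal P}_n: D(\mathrm{syn}(E'))E'\in T\}$ (correctable errors); $U=\tilde G^\perp=\{E'\in\tilde{\mathcal P}_n: E' \text{ commutes with every element of }\tilde G\}$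 (unsuppressed errors); $V=\tilde{\mathcal P}_n\setminus U$ (suppressed errors). For $A\subset\tilde{\mathcal P}_n$, $W(A;z)=\sum_{E'\in A}z^{\mathrm{wt}(E')}$. Hybrid LDD+QEC protocol. A random error $E'\in\tilde{\mathcal P}_n$ is drawn from the distribution obtained from $(1-p)^{n-\mathrm{wt}(E')}(p/3)^{\mathrm{wt}(E')}$ by multiplying the probabilities of all $E'\in V$ by $p_{\rm DD}$ and renormalizing to total mass $1$. The syndrome $\sigma=\mathrm{syn}(E')$ is measured. If $\sigma=0$, no recovery is applied ($R=\pi(I)$). If $\sigma\ne0$, then independently of $E'$ given $\sigma$, with probability $1-p_{\rm QEC}$ the recovery is $R=D(\sigma)$, and with probability $p_{\rm QEC}$ it is a uniformly random $R\in\tilde{\mathcal P}_n$ with $\mathrm{syn}(R)=\sigma$. The residual operator $RE'$ lies in $N$, and its class in $N/T$ is the induced logical Pauli. The fidelity $F_{\rm Hyb}$ is the probability that this class is trivial, i.e. that $RE'\in T$; it equals the entanglement fidelity of the induced logical Pauli channel on the codespace. *)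

(* Defs.v *)
From HB Require Import structures.
From mathcomp Require Import all_boot all_order all_algebra all_fingroup.

Set Implicit Arguments.
Unset Strict Implicit.
Unset Printing Implicit Defensive.

Import GroupScope GRing.Theory.

Local Open Scope group_scope.

Inductive letter := LI | LX | LY | LZ.

Definition ord_of_letter (a : letter) : 'I_4 :=
  match a with LI => inord 0 | LX => inord 1 | LY => inord 2 | LZ => inord 3 end.
Definition letter_of_ord (i : 'I_4) : letter :=
  match val i with 0 => LI | 1 => LX | 2 => LY | _ => LZ end.
Lemma ord_of_letterK : cancel ord_of_letter letter_of_ord.
Proof. by case; rewrite /letter_of_ord /= inordK. Qed.

HB.instance Definition _ := Finite.copy letter (can_type ord_of_letterK).

(* Product of two letters up to phase (Klein four-group). *)
Definition letter_mul (a b : letter) : letter :=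
  match a, b with
  | LI, c | c, LI => c
  | LX, LX | LY, LY | LZ, LZ => LI
  | LX, LY | LY, LX => LZ
  | LY, LZ | LZ, LY => LX
  | LZ, LX | LX, LZ => LY
  end.

Lemma letter_mulA : associative letter_mul. Proof. by do 3!case. Qed.
Lemma letter_mul1 : left_id LI letter_mul. Proof. by case. Qed.
Lemma letter_mulV : left_inverse LI id letter_mul. Proof. by case. Qed.

HB.instance Definition _ :=
  Finite_isGroup.Build letter letter_mulA letter_mul1 letter_mulV.

(* As Pauli matrices, a b = i ^ (letter_phase a b) (letter_mul a b):
   XY = iZ, YZ = iX, ZX = iY, and the reversed products carry -i = i ^ 3. *)
Definition letter_phase (a b : letter) : 'Z_4 :=
  match a, b with
  | LX, LY | LY, LZ | LZ, LX => 1%R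
  | LY, LX | LZ, LY | LX, LZ => (- 1)%R
  | _, _ => 0%R
  end.

(* The Pauli group modulo phases; the group law is the pointwise product. *)
Notation pstring n := {dffun forall _ : 'I_n, letter}.

(* [Pauli c E] is the operator i ^ c E_0 (x) ... (x) E_(n-1). *)
Record pauli (n : nat) := Pauli { phase : 'Z_4; letters : pstring n }.

Definition pair_of_pauli n (g : pauli n) := (phase g, letters g).
Definition pauli_of_pair n (u : 'Z_4 * pstring n) := Pauli u.1 u.2.
Lemma pair_of_pauliK n : cancel (@pair_of_pauli n) (@pauli_of_pair n).
Proof. by case. Qed.

HB.instance Definition _ n := Finite.copy (pauli n) (can_type (@pair_of_pauliK n)).

Definition pauli_mul n (g h : pauli n) : pauli n :=
  Pauli (phase g + phase h + \sum_i letter_phase (letters g i) (letters h i))%R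
        (letters g * letters h).
Definition pauli_one n : pauli n := Pauli 0%R 1.
Definition pauli_inv n (g : pauli n) : pauli n :=
  Pauli (- phase g)%R (letters g).

Lemma pstringM n (E F : pstring n) i : (E * F) i = E i * F i.
Proof. exact: ffunE. Qed.
Lemma pstring1 n i : (1 : pstring n) i = LI.
Proof. exact: ffunE. Qed.

Lemma letter_phaseA a b c :
  (letter_phase a b + letter_phase (a * b)%g c
   = letter_phase b c + letter_phase a (b * c)%g)%R.
Proof. by apply/val_inj; case: a b c; do 2!case. Qed.

Lemma pauli_mulA n : associative (@pauli_mul n).
Proof.
move=> g h k; rewrite /pauli_mul /= mulgA; congr Pauli.
have key : (\sum_i letter_phase (letters h i) (letters k i) +
    \sum_i letter_phase (letters g i) ((letters h * letters k)%g i) =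
  \sum_i letter_phase (letters g i) (letters h i) +
    \sum_i letter_phase ((letters g * letters h)%g i) (letters k i))%R.
  rewrite -!big_split; apply: eq_bigr => i _ /=.
  by rewrite !pstringM letter_phaseA.
rewrite -[LHS]addrA -[(phase h + phase k + _)%R]addrA -!addrA key !addrA.
by rewrite [(_ + phase k + _)%R]addrAC.
Qed.

Lemma pauli_mul1 n : left_id (@pauli_one n) (@pauli_mul n).
Proof.
move=> [c E]; rewrite /pauli_mul /= mul1g add0r big1 ?addr0 // => i _.
by rewrite pstring1.
Qed.

Lemma pauli_mulV n : left_inverse (@pauli_one n) (@pauli_inv n) (@pauli_mul n).
Proof.
move=> [c E]; rewrite /pauli_mul /= addNr add0r big1 => [|i _].
  by congr Pauli; apply/ffunP => i; rewrite pstringM pstring1; case: (E i).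
by case: (E i).
Qed.

HB.instance Definition _ n :=
  Finite_isGroup.Build (pauli n) (@pauli_mulA n) (@pauli_mul1 n) (@pauli_mulV n).

Definition minusI n : pauli n := Pauli (2%:R)%R 1.
Definition iI n : pauli n := Pauli 1%R 1.

Definition pi n (g : pauli n) : pstring n := letters g.
Lemma piM n : {in setT &, {morph @pi n : g h / g * h}}.
Proof. by []. Qed.
Canonical pi_morphism n := Morphism (@piM n).

Lemma iI_expg n m : iI n ^+ m = Pauli (m%:R)%R 1.
Proof.
elim: m => [//|m IHm]; rewrite expgS IHm /mulg /= /pauli_mul /= mul1g big1 ?addr0.
  by rewrite -natr1 addrC.
by move=> i _; rewrite pstring1.
Qed.

(* [pi] is the quotient map by the phases. *)
Lemma ker_pi n : 'ker (@pi n) = <[iI n]>.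
Proof.
apply/setP => g; apply/idP/cycleP => [|[m ->]].
  move/(mker (f := pi_morphism n)); case: g => c E /= -> {E}.
  by exists c; rewrite iI_expg natr_Zp.
by apply/kerP; rewrite ?inE // iI_expg.
Qed.
Lemma pi_surj n : @pi n @* setT = setT.
Proof.
apply/setP => E; rewrite inE; apply/morphimP.
by exists (Pauli 0%R E); rewrite ?inE.
Qed.

(* Representative with phase +1; by [pcommute_pi] and [anticommute_lift] below,
   (anti)commutation does not depend on the choice of representatives. *)
Definition plift n (E : pstring n) : pauli n := Pauli 0%R E.

Definition anticommute n (g h : pauli n) : bool := g * h == minusI n * (h * g).

Definition pcommute n (E F : pstring n) : bool := plift E * plift F == plift F * plift E.

Lemma pcommute_pi n (g h : pauli n) : pcommute (pi g) (pi h) = (g * h == h * g).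
Proof.
case: g h => a E [b F]; rewrite /pcommute /plift /pi /mulg /= /pauli_mul /=.
have inj (x y : 'Z_4) (A B : pstring n) :
  (Pauli x A == Pauli y B) = (x == y) && (A == B).
  by apply/eqP/andP => [[-> ->]|[/eqP-> /eqP->]].
by rewrite !inj !add0r [(b + a)%R]addrC (inj_eq (addrI _)).
Qed.

Definition wt n (E : pstring n) : nat := #|[set i | E i != LI]|.

Lemma letter_comm_phase a b : a * b = b * a :> letter.
Proof. by case: a b; case. Qed.

Lemma letter_phase_comm a b : exists c : bool,
  (letter_phase a b = c%:R * 2%:R + letter_phase b a)%R.
Proof.
exists (letter_phase a b != letter_phase b a).
by apply/eqP; case: a; case: b; vm_compute.
Qed.

Lemma addb_phase (b c : bool) :
  ((b (+) c)%:R * 2%:R = (b%:R + c%:R) * 2%:R :> 'Z_4)%R.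
Proof. by apply/eqP; case: b; case: c; vm_compute. Qed.

Lemma minusI_mul n (g : pauli n) : minusI n * g = Pauli (2%:R + phase g)%R (letters g).
Proof.
case: g => c E; rewrite /mulg /= /pauli_mul /= mul1g big1 ?addr0 // => i _.
by rewrite pstring1.
Qed.

Lemma minusI_comm n (g : pauli n) : minusI n * g = g * minusI n.
Proof.
rewrite minusI_mul; case: g => c E; rewrite /mulg /= /pauli_mul /= mulg1 big1.
  by rewrite addr0 addrC.
by move=> i _; rewrite pstring1; case: (E i).
Qed.

Lemma minusI_sq n : minusI n * minusI n = 1.
Proof. by rewrite minusI_mul; congr Pauli; apply/val_inj. Qed.

Lemma minusI_neq1 n : minusI n != 1.
Proof. by apply/eqP => /(congr1 (@phase n))/(congr1 val). Qed.

Lemma commuteVanticommute n (g h : pauli n) :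
  g * h = minusI n ^+ (anticommute g h) * (h * g).
Proof.
rewrite /anticommute; case: eqP => [//|nac]; rewrite mul1g.
have [b Hb] : exists b : bool,
  (\sum_i letter_phase (letters g i) (letters h i) =
   b%:R * 2%:R + \sum_i letter_phase (letters h i) (letters g i))%R.
  elim/big_rec2: _ => [|i y1 y2 _ [b ->]]; first by exists false; rewrite mul0r add0r.
  have [c ->] := letter_phase_comm (letters g i) (letters h i).
  by exists (c (+) b); rewrite addrACA -mulrDl addb_phase.
have EL : letters g * letters h = letters h * letters g.
  by apply/ffunP => i; rewrite !pstringM letter_comm_phase.
case: b Hb => Hb; last first.
  by rewrite /mulg /= /pauli_mul /= EL Hb mul0r add0r [(phase g + _)%R]addrC.
case: nac; rewrite minusI_mul /mulg /= /pauli_mul /= EL Hb mul1r.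
by rewrite [(phase g + _)%R]addrC addrCA.
Qed.

Lemma anticommuteM n (g h k : pauli n) :
  anticommute g (h * k) = anticommute g h (+) anticommute g k.
Proof.
have Hm (b1 b2 : bool) : minusI n ^+ b1 * minusI n ^+ b2 = minusI n ^+ (b1 (+) b2).
  by case: b1; case: b2; rewrite /= ?expg0 ?expg1 ?mulg1 ?mul1g ?minusI_sq.
have E : g * (h * k) = minusI n ^+ (anticommute g h (+) anticommute g k) * (h * k * g).
  rewrite mulgA (commuteVanticommute g h) -!mulgA (commuteVanticommute g k) -Hm.
  rewrite -!mulgA; congr (_ * _); rewrite !mulgA; congr (_ * _ * _).
  by case: (anticommute g k); rewrite ?expg1 ?expg0 ?mulg1 ?mul1g ?minusI_comm.
rewrite {1}/anticommute E; case: (_ (+) _); first by rewrite eqxx.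
by rewrite mul1g eq_sym -{2}[h * k * g]mul1g (inj_eq (mulIg _)) (negbTE (minusI_neq1 n)).
Qed.

Lemma anticommute_lift n (g h : pauli n) :
  anticommute (plift (pi g)) (plift (pi h)) = anticommute g h.
Proof.
have neg (x y : pauli n) : anticommute x y = ~~ (x * y == y * x).
  have := commuteVanticommute x y; case: anticommute => ->.
    by rewrite -{2}[y * x]mul1g (inj_eq (mulIg _)) (negbTE (minusI_neq1 n)).
  by rewrite mul1g eqxx.
by rewrite !neg -(pcommute_pi g h).
Qed.

(* F_2-dual of a finite group: the additive group Hom(G, F_2). *)
Definition is_hom (gT : finGroupType) (G : {group gT}) : {pred {ffun [subg G] -> 'F_2}} :=
  [pred f : {ffun [subg G] -> 'F_2} |
     [forall s, [forall t, f (s * t) == (f s + f t)%R]]].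
Arguments is_hom {gT} G.

Lemma is_hom_zmod_closed (gT : finGroupType) (G : {group gT}) : zmod_closed (is_hom G).
Proof.
split=> [|f h /forallP Hf /forallP Hh].
  by apply/forallP => s; apply/forallP => t; rewrite !ffunE addr0.
apply/forallP => s; apply/forallP => t; rewrite !ffunE.
by rewrite (eqP (forallP (Hf s) t)) (eqP (forallP (Hh s) t)) opprD addrACA.
Qed.
HB.instance Definition _ (gT : finGroupType) (G : {group gT}) :=
  GRing.isZmodClosed.Build _ (is_hom G) (is_hom_zmod_closed G).

Record F2dual (gT : finGroupType) (G : {group gT}) :=
  F2Dual { dual_fun :> {ffun [subg G] -> 'F_2}; dual_funP : dual_fun \in is_hom G }.

HB.instance Definition _ (gT : finGroupType) (G : {group gT}) :=
  [isSub for @dual_fun gT G].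
HB.instance Definition _ (gT : finGroupType) (G : {group gT}) :=
  [Finite of F2dual G by <:].
HB.instance Definition _ (gT : finGroupType) (G : {group gT}) :=
  [SubChoice_isSubZmodule of F2dual G by <:].

Definition syn_fun n (S : {group pauli n}) (E : pstring n) : {ffun [subg S] -> 'F_2} :=
  [ffun s => ((anticommute (plift E) (sgval s))%:R)%R].
Lemma syn_fun_hom n (S : {group pauli n}) (E : pstring n) : syn_fun S E \in is_hom S.
Proof.
apply/forallP => s; apply/forallP => t; rewrite !ffunE anticommuteM; apply/eqP/val_inj.
by do 2!case: anticommute.
Qed.
Definition syn n (S : {group pauli n}) (E : pstring n) : F2dual S :=
  F2Dual (syn_fun_hom S E).

Definition is_decoder n (S : {group pauli n}) (D : F2dual S -> pstring n) : Prop :=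
  D 0%R = 1 /\ forall sigma, syn S (D sigma) = sigma.

Definition is_logical_group n (S L : {group pauli n}) : Prop :=
  [/\ L \subset 'C(S), 'C(S) = S * L & (@pi n @* S) :&: (@pi n @* L) = 1].

Definition stabilizers n (S : {group pauli n}) : {set pstring n} := @pi n @* S.

Definition zero_syndrome n (S L : {group pauli n}) : {set pstring n} :=
  @pi n @* (S * L).

Definition correctable n (S : {group pauli n}) (D : F2dual S -> pstring n) :
    {set pstring n} :=
  [set E | D (syn S E) * E \in stabilizers S].

Definition unsuppressed n (G : {group pstring n}) : {set pstring n} :=
  [set E | [forall F in G, pcommute E F]].

Definition suppressed n (G : {group pstring n}) : {set pstring n} := ~: unsuppressed G.

(* Distance: least weight of an undetectable error acting nontrivially. *)
Definition has_distance n (S L : {group pauli n}) (d : nat) : Prop :=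
  (exists2 E, E \in zero_syndrome S L :\: stabilizers S & wt E = d) /\
  (forall E, E \in zero_syndrome S L :\: stabilizers S -> d <= wt E).

Local Open Scope ring_scope.

Definition W (R : realFieldType) n (A : {set pstring n}) (z : R) : R :=
  \sum_(E in A) z ^+ wt E.

Definition depolarizing (R : realFieldType) n (p : R) (E : pstring n) : R :=
  (1 - p) ^+ (n - wt E) * (p / 3) ^+ wt E.

Definition dd_weight (R : realFieldType) n (G : {group pstring n}) (p pDD : R)
    (E : pstring n) : R :=
  (if E \in suppressed G then pDD else 1) * depolarizing p E.

Definition error_prob (R : realFieldType) n (G : {group pstring n}) (p pDD : R)
    (E : pstring n) : R :=
  dd_weight G p pDD E / \sum_F dd_weight G p pDD F.

(* Probability of applying the recovery [r] given the syndrome [sigma]. *)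
Definition recovery_prob (R : realFieldType) n (S : {group pauli n})
    (D : F2dual S -> pstring n) (pQEC : R) (sigma : F2dual S) (r : pstring n) : R :=
  if sigma == 0 then (r == 1%g)%:R
  else (1 - pQEC) * (r == D sigma)%:R
       + pQEC * ((syn S r == sigma)%:R / #|[set r' | syn S r' == sigma]|%:R).

(* Distribution of the induced logical Pauli, i.e. of the class of the
   residual operator [r * E] modulo the stabilizers. *)
Definition logical_channel (R : realFieldType) n (S : {group pauli n})
    (D : F2dual S -> pstring n) (G : {group pstring n}) (p pDD pQEC : R)
    (c : coset_of (stabilizers S)) : R :=
  \sum_E \sum_(r | coset (stabilizers S) (r * E)%g == c)
    error_prob G p pDD E * recovery_prob D pQEC (syn S E) r.

(* The entanglement fidelity of a Pauli channel is its weight on the identity. *)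
Definition hybrid_fidelity (R : realFieldType) n (S : {group pauli n})
    (D : F2dual S -> pstring n) (G : {group pstring n}) (p pDD pQEC : R) : R :=
  logical_channel D G p pDD pQEC 1%g.

(* Main.v *)
(* An error with nonzero syndrome that meets a uniformly random recovery is
   corrected with probability |T| / |N|, because its recoveries form a coset of
   N and the good ones a coset of T.  Summing (-1)^[E anticommutes with s] over
   all pairs (E, s) in two ways gives |N| |S| = 4^n, so that |T| / |N| = 4^-k.
   The rest uses that N and K meet in T, since D(0) = 1. *)

Require Import Defs.
From HB Require Import structures.
From mathcomp Require Import all_boot all_order all_algebra all_fingroup.
From mathcomp Require Import ring lra.

Set Implicit Arguments.
Unset Strict Implicit.
Unset Printing Implicit Defensive.

Import Order.TTheory GRing.Theory Num.Theory.
Local Open Scope ring_scope.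

(** * Sign sums and commutation in the Pauli group *)

(** Orthogonality of characters: if [f a] holds for some [a] in [A], translation by [a] permutes [A]
    and flips every sign, so the sum equals its own negative. *)
Lemma sum_sign_hom (gT : finGroupType) (A : {group gT}) (f : gT -> bool) :
  {in A &, {morph f : x y / (x * y)%g >-> x (+) y}} ->
  \sum_(x in A) (-1) ^+ f x =
    (if [forall x in A, ~~ f x] then #|A| else 0%N)%:Z.
Proof.
move=> fM; case: ifPn => [/forall_inP f0|].
  rewrite (eq_bigr (fun=> 1)) => [|x /f0/negbTE->//].
  by rewrite sumr_const natz.
rewrite negb_forall => /existsP[a]; rewrite negb_imply negbK => /andP[Aa fa].
have H : \sum_(x in A) (-1) ^+ f x = - \sum_(x in A) (-1) ^+ f x :> int.
  rewrite {1}(reindex_inj (mulgI a)) -sumrN; apply: eq_big => [x|x Ax].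
    by rewrite groupMl.
  rewrite groupMl // in Ax; rewrite fM // fa.
  by case: (f x).
by rewrite (_ : \sum_(x in A) _ = 0) //; lra.
Qed.

Lemma letter_sq (a : letter) : (a * a = 1)%g.
Proof. by case: a. Qed.

Lemma pstringC n (E F : pstring n) : (E * F = F * E)%g.
Proof. by apply/ffunP => i; rewrite !pstringM letter_comm_phase. Qed.

Lemma pstring_sq n (E : pstring n) : (E * E = 1)%g.
Proof. by apply/ffunP => i; rewrite pstringM pstring1 letter_sq. Qed.

Lemma card_pstring n : #|{: pstring n}| = (4 ^ n)%N.
Proof.
suff cl : #|{: letter}| = 4 by rewrite card_ffun cl card_ord.
rewrite -[RHS](card_ord 4); apply: (@bij_eq_card _ _ ord_of_letter).
exists letter_of_ord; first exact: ord_of_letterK.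
by case=> [] [|[|[|[|]]]] // lt4; apply/val_inj; rewrite /= inordK.
Qed.

Lemma anticommuteC n (g h : pauli n) : anticommute g h = anticommute h g.
Proof.
have key (x y : pauli n) : anticommute x y -> anticommute y x.
  by rewrite /anticommute => /eqP->; rewrite mulgA minusI_sq mul1g.
by apply/idP/idP; apply: key.
Qed.

Lemma anticommute_plift_letters n (g h : pauli n) :
  anticommute (plift (letters g)) h = anticommute g h.
Proof. by rewrite -[LHS]anticommute_lift -[RHS]anticommute_lift. Qed.

(** [plift] is not multiplicative, but [plift E * plift F] differs from [plift (E * F)] only by a
    phase, which anticommutation ignores. *)
Lemma anticommute_pliftM n (E F : pstring n) (g : pauli n) :
  anticommute (plift (E * F)%g) g =
    anticommute (plift E) g (+) anticommute (plift F) g.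
Proof.
rewrite (anticommute_plift_letters (plift E * plift F)%g).
by rewrite anticommuteC anticommuteM ![anticommute g _]anticommuteC.
Qed.

(** Nondegeneracy of the commutation form: a non-identity letter at position [i] is detected by a
    one-qubit Pauli at [i] carrying a different non-identity letter. *)
Lemma commutes_all_letters1 n (g : pauli n) :
  (forall E, ~~ anticommute (plift E) g) -> letters g = 1%g.
Proof.
move=> cg; apply/ffunP => i; rewrite pstring1; apply/eqP/negPn/negP => gi.
have [b hb] : exists b : letter,
    letter_phase b (letters g i) != letter_phase (letters g i) b.
  by case: (letters g i) gi; rewrite ?eqxx // => _; [exists LY | exists LX | exists LX].
pose E : pstring n := [ffun j => if j == i then b else LI].
have := commuteVanticommute (plift E) g.
rewrite (negbTE (cg E)) mul1g => /(congr1 (@phase n)) /=.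
rewrite add0r addr0 => /addrI.
rewrite (bigD1 i) // [RHS](bigD1 i) //= !big1 ?addr0 => [|j|j].
- by rewrite ffunE eqxx => /eqP; rewrite (negbTE hb).
- by move=> /negbTE ji; rewrite ffunE ji; case: (letters g j).
- by move=> /negbTE ji; rewrite ffunE ji.
Qed.

(** Among the pure phases, -I is excluded by hypothesis, and iI and -iI are excluded because their
    square is -I. *)
Lemma letters_eq1_in n (S : {group pauli n}) :
  minusI n \notin S -> {in S, forall g, letters g = 1%g -> g = 1%g}.
Proof.
move=> SI [c E] Sg; rewrite /= => E1; rewrite {E}E1 in Sg *.
have := groupM Sg Sg.
have -> : (Pauli c 1%g * Pauli c 1%g)%g = Pauli (c + c) 1%g :> pauli n.
  rewrite /mulg /= /pauli_mul /= mul1g big1 ?addr0 // => i _.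
  by rewrite pstring1.
move: c Sg SI; rewrite /minusI.
have c4 (c : 'Z_4) : [\/ c = 0, c + c = 2%:R | c = 2%:R].
  case: c => [] [|[|[|[|]]]] // lt4;
    [apply: Or31 | apply: Or32 | apply: Or33 | apply: Or32]; exact/val_inj.
move=> c Sg SI; case: (c4 c) => [-> //|->|Ec]; first by rewrite (negbTE SI).
by move: Sg; rewrite Ec (negbTE SI).
Qed.

(** * Syndromes and the centralizer *)

Lemma syn_eqE n (S : {group pauli n}) (E F : pstring n) :
  (syn S E == syn S F) =
  [forall s in S, anticommute (plift E) s == anticommute (plift F) s].
Proof.
apply/eqP/forall_inP => [/(congr1 (@dual_fun _ _)) /ffunP eqEF s Ss|eqEF].
  have := eqEF (subg S s); rewrite !ffunE subgK //.
  by do 2!case: anticommute => //.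
by apply/val_inj/ffunP => s; rewrite !ffunE (eqP (eqEF _ (subgP s))).
Qed.

Lemma anticommute1 n (g : pauli n) : ~~ anticommute (plift 1%g) g.
Proof.
have := anticommute_pliftM 1%g 1%g g.
by rewrite mulg1; case: anticommute.
Qed.

Lemma syn1 n (S : {group pauli n}) : syn S 1%g = 0.
Proof.
by apply/val_inj/ffunP => s; rewrite !ffunE (negbTE (anticommute1 _)).
Qed.

Lemma syn_mul_eq n (S : {group pauli n}) (E F : pstring n) :
  (syn S (E * F)%g == 0) = (syn S E == syn S F).
Proof.
rewrite -(syn1 S) !syn_eqE; apply: eq_forallb => s.
rewrite anticommute_pliftM (negbTE (anticommute1 _)).
by do 2!case: anticommute.
Qed.

Lemma anticommuteN n (g h : pauli n) : ~~ anticommute g h = (g * h == h * g)%g.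
Proof.
have := commuteVanticommute g h; case: anticommute => ->.
  by rewrite -{2}[(h * g)%g]mul1g (inj_eq (mulIg _)) (negbTE (minusI_neq1 n)).
by rewrite mul1g eqxx.
Qed.

(* Qualified because generic_quotient also exports a [pi]. *)
Lemma pi_centralizer n (S : {group pauli n}) E :
  (E \in @Defs.pi n @* 'C(S))%g = (syn S E == 0).
Proof.
rewrite -(syn1 S) syn_eqE; apply/morphimP/forall_inP => [[g _ /centP cg ->] s Ss|cE].
  rewrite (negbTE (anticommute1 _)) anticommute_plift_letters.
  by rewrite eqbF_neg anticommuteN; apply/eqP/cg.
exists (plift E); rewrite ?inE //; apply/centP => s Ss; apply/eqP.
by rewrite -anticommuteN (eqP (cE s Ss)) anticommute1.
Qed.

(** * Counting stabilizers, zero-syndrome errors and syndrome fibers *)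

(** The projection is injective on [S]: if [g] and [h] have the same letters, then [g * h^-1] is a
    pure phase in [S], hence 1. *)
Lemma card_stabilizers n (S : {group pauli n}) :
  minusI n \notin S -> #|stabilizers S| = #|S|.
Proof.
move=> SI; rewrite /stabilizers morphimEsub ?subsetT //.
apply: card_in_imset => g h Sg Sh pgh; apply/eqP; rewrite eq_mulgV1; apply/eqP.
apply: (letters_eq1_in SI); first by rewrite groupM ?groupV.
by rewrite /= -[letters h]/(Defs.pi h) -[Defs.pi h]pgh pstring_sq.
Qed.

Lemma card_syndrome0 n (S : {group pauli n}) : minusI n \notin S ->
  (#|[set E | syn S E == 0%R]| * #|S| = 4 ^ n)%N.
Proof.
move=> SI.
pose chi (E : pstring n) (s : pauli n) : int := (-1) ^+ anticommute (plift E) s.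
(* For fixed [E] the signs form a character of [S], trivial exactly when [E] has zero syndrome. *)
have byE E : \sum_(s in S) chi E s = ((syn S E == 0%R) * #|S|)%N%:Z.
  rewrite sum_sign_hom => [|s t _ _]; last exact: anticommuteM.
  congr (Posz _); rewrite -(syn1 S) syn_eqE.
  under [in RHS]eq_forallb do rewrite (negbTE (anticommute1 _)) eqbF_neg.
  by case: ifP => _; rewrite ?mul1n.
have by1 : \sum_(E : pstring n) chi E 1%g = (4 ^ n)%N%:Z.
  rewrite (eq_bigr (fun=> 1)) => [|E _]; last first.
    suff : anticommute (plift E) 1%g = false by rewrite /chi => ->.
    by rewrite anticommuteC; apply/negbTE/(anticommute1 (plift E)).
  by rewrite sumr_const card_pstring natz.
(* For fixed [s] the signs form a character in [E]; were it trivial, [s] would be a pure phase,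
   hence 1. *)
have byS s : s \in S -> s != 1%g -> \sum_(E : pstring n) chi E s = 0.
  move=> Ss s1; rewrite (eq_bigl (mem [set: pstring n])) => [|E]; last by rewrite !inE.
  rewrite (sum_sign_hom (A := [set: pstring n]%G)
             (f := fun E => anticommute (plift E) s)) => [|E F _ _]; last first.
    exact: anticommute_pliftM.
  case: ifP => // /forall_inP cs; case/eqP: s1; apply: (letters_eq1_in SI Ss).
  by apply: commutes_all_letters1 => E; apply: cs; rewrite inE.
have : \sum_(s in S) \sum_E chi E s = (4 ^ n)%N%:Z.
  rewrite (bigD1 1%g) //= by1 big1 ?addr0 // => s /andP[].
  exact: byS.
rewrite exchange_big (eq_bigr _ (fun E _ => byE E)).
rewrite -(big_morph _ PoszD (erefl _)) -big_distrl => -[<-].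
by rewrite -sum1dep_card [in LHS]big_mkcond.
Qed.

Lemma coset_stabilizers_eq1 n (S : {group pauli n}) (E : pstring n) :
  (coset (stabilizers S) E == 1%g) = (E \in stabilizers S).
Proof.
rewrite /stabilizers; apply/eqP/idP; last exact: coset_id.
(* [coset] also sends everything outside the normalizer to 1, so membership in the normalizer must
   be shown; it holds because Pauli strings commute. *)
apply: coset_idr; apply: (subsetP (cent_sub _)).
by apply/centP => F _; apply: pstringC.
Qed.

(** Right translation by [E] maps the fiber bijectively onto the zero-syndrome set. *)
Lemma card_syn_fiber n (S : {group pauli n}) (E : pstring n) :
  #|[set r | syn S r == syn S E]| = #|[set F | syn S F == 0]|.
Proof.
rewrite -(card_preimset [set F | syn S F == 0] (mulIg E)).
by apply: eq_card => r; rewrite !inE -syn_mul_eq.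
Qed.

Lemma card_zero_syndrome n k (S : {group pauli n}) : (k <= n)%N ->
  #|S| = (2 ^ (n - k))%N -> minusI n \notin S ->
  (#|[set E | syn S E == 0%R]| = 4 ^ k * #|S|)%N.
Proof.
(* Multiplying by [#|S|] turns the claim into 4^n = 4^k 4^(n-k). *)
move=> kn hS SI; apply/eqP; rewrite -(eqn_pmul2r (cardG_gt0 S)).
rewrite card_syndrome0 // -mulnA hS -expnD addnn -mul2n expnM -expnD.
by rewrite subnKC.
Qed.

Lemma zero_syndromeE n (S L : {group pauli n}) (E : pstring n) :
  is_logical_group S L ->
  (E \in zero_syndrome S L) = (syn S E == 0).
Proof. by case=> _ defC _; rewrite /zero_syndrome -defC; apply: pi_centralizer. Qed.

Lemma stabilizer_syndrome n (S L : {group pauli n}) (E : pstring n) :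
  is_logical_group S L -> E \in stabilizers S -> syn S E == 0.
Proof.
move=> hL; rewrite -(zero_syndromeE _ hL); apply: subsetP; apply: morphimS.
by rewrite mulG_subl.
Qed.

(** * Success probability of the recovery for a fixed error *)

Lemma sum_delta (R : pzSemiRingType) (I : finType) (P : pred I) (a : I) :
  \sum_(r | P r) (r == a)%:R = (P a)%:R :> R.
Proof.
rewrite big_mkcond (bigD1 a) //= eqxx big1 ?addr0 => [|r /negbTE->].
  by case: (P a).
by case: (P r).
Qed.

Lemma recovery_success (R : realFieldType) (n k : nat) (S L : {group pauli n})
    (D : F2dual S -> pstring n) (q : R) (E : pstring n) :
  (k <= n)%N -> #|S| = (2 ^ (n - k))%N -> minusI n \notin S ->
  is_logical_group S L -> is_decoder D ->
  \sum_(r | coset (stabilizers S) (r * E)%g == 1%g)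
      recovery_prob D q (syn S E) r =
  1 - ((E \notin correctable D)%:R
       + q * ((E \in correctable D :\: stabilizers S)%:R
              - 4 ^- k * (E \notin zero_syndrome S L)%:R)).
Proof.
move=> kn hS SI hL hD.
under eq_bigl do rewrite coset_stabilizers_eq1.
rewrite (zero_syndromeE _ hL) /recovery_prob in_setD inE.
(* For zero syndrome, [D 0 = 1] makes [E] correctable exactly when it is a stabilizer, so the
   coefficient of [q] vanishes. *)
case: (altP (syn S E =P 0)) => [E0|En0].
  rewrite sum_delta mul1g E0 (proj1 hD) mul1g.
  by case: (E \in _) => /=; ring.
have -> : E \in stabilizers S = false.
  by apply/negbTE/(contra (stabilizer_syndrome hL)).
have cardT : (\sum_(r | (r * E)%g \in stabilizers S) 1 = #|S|)%N.
  rewrite -(card_stabilizers SI) -(card_preimset (stabilizers S) (mulIg E)).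
  by rewrite -sum1_card; apply: eq_bigl => r; rewrite inE.
(* If [r * E] is a stabilizer, then [r] has the syndrome of [E]; so all [#|S|] successful recoveries
   lie in the fiber, whose size is 4^k [#|S|]. *)
have unifT : \sum_(r | (r * E)%g \in stabilizers S)
    (syn S r == syn S E)%:R / #|[set r' | syn S r' == syn S E]|%:R = 4 ^- k :> R.
  have S0 : #|S|%:R != 0 :> R by rewrite pnatr_eq0 -lt0n cardG_gt0.
  rewrite -mulr_suml (eq_bigr (fun=> 1%:R)) => [|r rET].
    rewrite -natr_sum cardT card_syn_fiber (card_zero_syndrome kn hS SI).
    by rewrite natrM natrX invfM mulrCA divff // mulr1.
  by rewrite -syn_mul_eq (stabilizer_syndrome hL rET).
rewrite big_split /= -!mulr_sumr sum_delta unifT /=.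
by case: (_ \in _) => /=; ring.
Qed.

(** * Weight enumerators and the normalized error distribution *)

Lemma W_mem (R : realFieldType) n (A : {set pstring n}) (z : R) :
  W A z = \sum_E (E \in A)%:R * z ^+ wt E.
Proof.
by rewrite /W big_mkcond; apply: eq_bigr => E _; case: (E \in A); rewrite ?mul1r ?mul0r.
Qed.

Lemma wt_le n (E : pstring n) : (wt E <= n)%N.
Proof. by rewrite -[X in (_ <= X)%N](card_ord n) max_card. Qed.

(** Factoring out (1-p)^n leaves (p/3)/(1-p) per non-identity letter; [wt_le] makes the truncated
    subtraction [n - wt E] exact. *)
Lemma depolarizingE (R : realFieldType) n (p : R) (E : pstring n) : p < 1 ->
  depolarizing p E = (1 - p) ^+ n * (p / (3 - 3 * p)) ^+ wt E.
Proof.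
move=> p1.
have -> : (1 - p) ^+ n = (1 - p) ^+ (n - wt E) * (1 - p) ^+ wt E.
  by rewrite -exprD subnK ?wt_le.
rewrite /depolarizing -mulrA -exprMn.
by congr (_ * _ ^+ _); field; rewrite gt_eqF; lra.
Qed.

Lemma unsuppressed1 n (G : {group pstring n}) : 1%g \in unsuppressed G.
Proof. by rewrite inE; apply/forall_inP => F _; rewrite /pcommute mulg1 mul1g. Qed.

Theorem theorem1 (R : realFieldType) (n k d : nat) (hk : (1 <= k)%N) (hkn : (k <= n)%N)
    (S L : {group pauli n})
    (hS : #|S| = (2 ^ (n - k))%N) (hSI : minusI n \notin S)
    (hL : is_logical_group S L) (hd : has_distance S L d)
    (D : F2dual S -> pstring n) (hD : is_decoder D)
    (G : {group pstring n}) (hG : G != 1%G)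
    (p pDD pQEC z : R) (hp0 : 0 <= p) (hp1 : p < 1)
    (hz : z = p / (3 - 3 * p))
    (hDD0 : 0 <= pDD) (hDD1 : pDD <= 1)
    (hQEC0 : 0 <= pQEC) (hQEC1 : pQEC <= 1) :
  let T := stabilizers S in
  let N := zero_syndrome S L in
  let K := correctable D in
  let U := unsuppressed G in
  let V := suppressed G in
  1 - hybrid_fidelity D G p pDD pQEC =
    ((W (U :\: K) z
      + pQEC * (W ((U :&: K) :\: T) z - 4 ^- k * W (U :\: N) z))
     + pDD * (W (V :\: K) z
      + pQEC * (W ((V :&: K) :\: T) z - 4 ^- k * W (V :\: N) z)))
    / (W U z + pDD * W V z).
Proof.
move=> T N K U V.
(* [a E] is the error distribution up to normalization, [e E] the probability
   that the protocol fails on [E]. *)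
pose a E : R := (if E \in V then pDD else 1) * z ^+ wt E.
pose e E : R := (E \notin K)%:R +
  pQEC * ((E \in K :\: T)%:R - 4 ^- k * (E \notin N)%:R).
have ddE E : dd_weight G p pDD E = (1 - p) ^+ n * a E.
  by rewrite /dd_weight depolarizingE // /a hz mulrCA.
have q0 : (1 - p) ^+ n != 0 by rewrite expf_neq0 // subr_eq0 gt_eqF.
have z0 : 0 <= z.
  by rewrite hz divr_ge0 //; lra.
have a0 E : 0 <= a E by rewrite mulr_ge0 ?exprn_ge0 //; case: ifP.
(* The identity is unsuppressed and contributes 1, even when [pDD] or [z] is 0; all other terms are
   nonnegative. *)
have sa0 : \sum_E a E != 0.
  rewrite gt_eqF // (bigD1 1%g) //= ltr_wpDr ?sumr_ge0 //.
  rewrite /a inE unsuppressed1 mul1r /wt.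
  rewrite (_ : [set _ | _] = set0) ?cards0 ?expr0 //.
  by apply/setP => i; rewrite !inE pstring1 eqxx.
have epE E : error_prob G p pDD E = a E / \sum_F a F.
  rewrite /error_prob ddE (eq_bigr (fun F => (1 - p) ^+ n * a F)) //.
  by rewrite -mulr_sumr -mulf_div divff // mul1r.
have -> : hybrid_fidelity D G p pDD pQEC = \sum_E (a E / \sum_F a F) * (1 - e E).
  apply: eq_bigr => E _; rewrite -mulr_sumr epE.
  by rewrite (recovery_success _ _ hkn hS hSI hL hD).
(* The error probabilities sum to 1, so the complement averages [e]. *)
have -> : 1 - \sum_E (a E / \sum_F a F) * (1 - e E) =
    (\sum_E a E * e E) / \sum_F a F.
  rewrite (eq_bigr (fun E => a E / (\sum_F a F) - a E * e E / \sum_F a F)).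
    by rewrite sumrB -!mulr_suml divff // opprB addrC subrK.
  by move=> E _; rewrite mulrBr mulr1; congr (_ - _); apply: mulrAC.
(* Written with indicators, numerator and denominator agree term by term in [E], by cases on its
   memberships. *)
congr (_ / _); rewrite !W_mem ?mulr_sumr -?sumrB ?mulr_sumr -?big_split /=.
  rewrite ?mulr_sumr -?big_split /=.
  apply: eq_bigr => E _; rewrite /a /e !in_setD !in_setI.
  rewrite (_ : E \in V = (E \notin U)) ?in_setC //.
  by case: (E \in U); case: (E \in K); case: (E \in T); case: (E \in N) => /=; ring.
apply: eq_bigr => E _; rewrite /a (_ : E \in V = (E \notin U)) ?in_setC //.
by case: (E \in U) => /=; ring.
Qed.
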